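(* Let $\alpha\in(0,2)$, $\lambda>0$, $t>0$, let $\sigma$ be a finite Borel measure on $\mathbb S^{d-1}$ and let $q:\mathbb S^{d-1}\times(0,\infty)\to[0,\infty)$ be a Borel function with $0\le q\le1$ and $u\mapsto q(\xi,u)$ nonincreasing for each $\xi$. Suppose $q\in\mathrm{CF}_{\alpha,d}(\epsilon,M_\bullet,p(\cdot),\sigma)$, and set $\delta_0=\epsilon e^{-\lambda t}$. Then, for $\sigma$-a.e. $\xi\in\mathbb S^{d-1}$ for which $\int_0^\infty(q(\xi,u)-q(\xi,ue^{\lambda t}))u^{-1-\alpha}\,\mathrm du>0$ (so that $\kappa_\xi$ and $f_\xi$ below are defined), $$f_\xi(u)\le V_1g_1(u),\qquad u>0,$$ where $$\kappa_\xi=\frac{1}{\int_0^\infty\left(q(\xi,u)-q(\xi,ue^{\lambda t})\right)u^{-1-\alpha}\,\mathrm du},\qquad f_\xi(u)=\kappa_\xi\left(q(\xi,u)-q(\xi,ue^{\lambda t})\right)u^{-1-\alpha},$$ $g_1$ is the probability density function of $\mathrm{MLL}(\alpha,p(\xi),\delta_0)$, and $$V_1=\kappa_\xi\,\frac{\alpha\delta_0^{p(\xi)}+p(\xi)-\alpha}{\delta_0^\alpha\,\alpha\,(p(\xi)-\alpha)}\max\left\{1,M_\xi\left(e^{p(\xi)\lambda t}-1\right)\right\}.$$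
   Context: $\mathbb S^{d-1}$ is the unit sphere of $\mathbb R^d$. Class F: $q\in\mathrm{CF}_{\alpha,d}(\epsilon,M_\bullet,p(\cdot),\sigma)$ (for the fixed $\lambda,t>0$) means that $\epsilon>0$ and $p(\cdot),M_\bullet:\mathbb S^{d-1}\to[0,\infty)$ are Borel functions with $\inf_{\xi\in\mathbb S^{d-1}}p(\xi)>\alpha$ and $\int_{\mathbb S^{d-1}}M_\xi(e^{p(\xi)\lambda t}-1)\,\sigma(\mathrm d\xi)<\infty$, such that for any $u,v\in(0,\epsilon)$ and $\sigma$-a.e. $\xi$, $|q(\xi,u)-q(\xi,v)|\le M_\xi|u^{p(\xi)}-v^{p(\xi)}|$. Modified log-Laplace distribution: for $p>\alpha>0$ and $\delta>0$, $\mathrm{MLL}(\alpha,p,\delta)$ is the distribution with density $$g(x;\alpha,p,\delta)=\alpha(p-\alpha)\frac{\delta^\alpha}{\alpha\delta^p+p-\alpha}\left(x^{p-\alpha-1}1_{[0<x\le\delta]}+x^{-1-\alpha}1_{[x>\delta]}\right).$$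
   Formalization: At the single point u = δ₀ the inequality is asserted only if q(ξ,·) is left-continuous at ε; without this it can fail there (e.g. M = 0, ε = λ = t = 1, α = 1/2, p = 3/2, q = 1 for u < 1 and 0 for u ≥ 1). All other u > 0 are unconditional. *)

(* Defs.v *)
From HB Require Import structures.
From mathcomp Require Import all_boot all_order all_algebra.
From mathcomp Require Import all_classical all_reals all_analysis.

Set Implicit Arguments.
Unset Strict Implicit.
Unset Printing Implicit Defensive.
Import Order.TTheory GRing.Theory Num.Theory.
Import numFieldNormedType.Exports.
Local Open Scope classical_set_scope.
Local Open Scope ring_scope.

(* The unit sphere S^n of R^(n+1), i.e. S^(d-1) for d = n+1 >= 1.  The norm is
   spelled out because `|x| on 'rV[R]_n.+1 is the sup norm; the topology of
   'rV[R]_n.+1 is nevertheless the Euclidean one. *)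
Definition unit_sphere (R : realType) (n : nat) : set 'rV[R]_n.+1 :=
  [set x | Num.sqrt (\sum_(i < n.+1) x ord0 i ^+ 2) = 1].
Arguments unit_sphere : clear implicits.

Lemma unit_sphere_delta (R : realType) (n : nat) :
  delta_mx ord0 ord0 \in unit_sphere R n.
Proof.
rewrite inE /unit_sphere/= (bigD1 ord0)//= big1 ?addr0; last first.
  by move=> i i0; rewrite mxE eqxx/= (negPf i0) expr0n.
by rewrite mxE !eqxx/= expr1n sqrtr1.
Qed.

HB.instance Definition _ (R : realType) (n : nat) :=
  isPointed.Build (set_type (unit_sphere R n))
    (SigSub (unit_sphere_delta R n)).

(* The sphere with its Borel sigma-algebra, generated by the open sets of the
   topology induced by R^(n+1). *)
Definition sphere (R : realType) (n : nat) :=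
  g_sigma_algebraType (@open (set_type (unit_sphere R n))).

(* q is defined on sphere x (0, +oo) only: the values of the total function
   [q xi : R -> R] at u <= 0 are irrelevant. The exceptional null set may
   depend on the pair (u, v). *)
Definition CF (R : realType) (n : nat) (alpha lambda t : R)
    (eps : R) (M p : sphere R n -> R)
    (sigma : {finite_measure set (sphere R n) -> \bar R})
    (q : sphere R n -> R -> R) : Prop :=
  [/\ 0 < eps,
      measurable_fun [set: sphere R n] p /\ (forall xi, 0 <= p xi),
      measurable_fun [set: sphere R n] M /\ (forall xi, 0 <= M xi),
      alpha < inf (range p) /\
      (\int[sigma]_xi (M xi * (expR (p xi * lambda * t) - 1))%:E < +oo)%E &
      forall u v : R, 0 < u < eps -> 0 < v < eps ->
        {ae sigma, forall xi,
          `|q xi u - q xi v| <= M xi * `|u `^ p xi - v `^ p xi|}].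

(* Density of the modified log-Laplace distribution MLL(alpha, p, delta). *)
Definition mll_pdf (R : realType) (alpha p delta : R) (x : R) : R :=
  alpha * (p - alpha) * (delta `^ alpha / (alpha * delta `^ p + p - alpha)) *
  (x `^ (p - alpha - 1) * \1_`]0, delta] x +
   x `^ (- 1 - alpha) * \1_`]delta, +oo[ x).

Section normalised_density.
Variables (R : realType) (n : nat) (alpha lambda t : R).
Variables (q : sphere R n -> R -> R) (xi : sphere R n).

Definition f_unnorm (u : R) : R :=
  (q xi u - q xi (u * expR (lambda * t))) * u `^ (- 1 - alpha).

Definition f_mass : \bar R :=
  (\int[lebesgue_measure]_(u in `]0%R, +oo[) (f_unnorm u)%:E)%E.

(* Used only where 0 < f_mass; an infinite mass would give kappa = 0 = 1/oo. *)
Definition kappa : R := (fine f_mass)^-1.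

Definition f_dens (u : R) : R := kappa * f_unnorm u.

End normalised_density.

Definition V1 (R : realType) (n : nat) (alpha lambda t : R)
    (q : sphere R n -> R -> R) (M p : sphere R n -> R) (delta0 : R)
    (xi : sphere R n) : R :=
  kappa alpha lambda t q xi *
  ((alpha * delta0 `^ p xi + p xi - alpha) /
   (delta0 `^ alpha * alpha * (p xi - alpha))) *
  Num.max 1 (M xi * (expR (p xi * lambda * t) - 1)).

(* Main.v *)
Require Import Defs.
From HB Require Import structures.
From mathcomp Require Import all_boot all_order all_algebra.
From mathcomp Require Import all_classical all_reals all_analysis.
From mathcomp Require Import ring lra.

Set Implicit Arguments.
Unset Strict Implicit.
Unset Printing Implicit Defensive.
Import Order.TTheory GRing.Theory Num.Theory.
Import numFieldNormedType.Exports.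
Local Open Scope classical_set_scope.
Local Open Scope ring_scope.

(** The constants in [V1] and in the density of MLL cancel, so the claim is that
    the increment q(u) - q(u e^(lambda t)) is at most max(1, C) for u > delta0
    and at most max(1, C) u^p for u <= delta0, where C = M (e^(p lambda t) - 1).
    In fact it is at most 1 in the first case and at most C u^p in the second.
    The first bound holds because 0 <= q <= 1.  The second is the CF condition
    at the pair (u, u e^(lambda t)), both of whose entries are below eps exactly
    when u < delta0; at u = delta0 the upper entry is eps itself, and the
    condition is carried there by left-continuity of q.

    The CF condition holds outside a null set that depends on the pair, while
    the claim needs one null set for all u.  The null sets of the countably many
    rational pairs can be discarded at once, and for a remaining xi the
    inequality passes from rational to real pairs ([modulus_of_rat]): as q is
    monotone, widening a pair to a rational one can only increase the increment
    of q, and the power function on the other side is continuous. *)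

Lemma continuous_powRl (R : realType) (p x : R) :
  0 < x -> {for x, continuous (fun y : R => y `^ p)}.
Proof.
move=> x0; apply: differentiable_continuous; apply/derivable1_diffP.
have := is_derive1_powR p x0.
by case.
Qed.

(** The endpoints are allowed for [c], which makes the lemma a one-sided limit
    statement on either side of [c]. *)
Lemma le_continuous_of_rat (R : realType) (g : R -> R) (a b c D : R) :
  a < b -> a <= c <= b -> {for c, continuous g} ->
  (forall r : rat, ratr r \in `]a, b[ -> D <= g (ratr r)) -> D <= g c.
Proof.
move=> ab /andP[ac cb] gc Dg; rewrite leNgt; apply/negP => gD.
have /nbhs_ballP[e /= e0 He] : \forall x \near c, g x < D.
  exact: (cvgr_lt _ gc).
have [r] : exists r : rat, ratr r \in `]Num.max a (c - e), Num.min b (c + e)[.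
  apply: rat_in_itvoo; rewrite lt_min !gt_max; apply/andP; split.
    by rewrite ab/=; lra.
  by apply/andP; split; lra.
rewrite in_itv/= gt_max lt_min => /andP[/andP[ar cr] /andP[rb rc]].
have := Dg r; rewrite in_itv/= ar rb => /(_ isT).
rewrite leNgt => /negP; apply; apply: He.
by rewrite /ball/= ltr_norml; apply/andP; split; lra.
Qed.

(** Widening [u, v] to a rational interval [r, s] can only increase the
    increment of a monotone [h]; letting s decrease to v and then r increase to
    u moves just the continuous side of the inequality. *)
Lemma modulus_of_rat (R : realType) (h phi : R -> R) (K a b : R) :
  {in `]a, b[ &, {homo h : x y /~ x <= y}} ->
  {in `]a, b[, continuous phi} ->
  (forall r s : rat, ratr r \in `]a, b[ -> ratr s \in `]a, b[ ->
    `|h (ratr r) - h (ratr s)| <= K * `|phi (ratr r) - phi (ratr s)|) ->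
  {in `]a, b[ &, forall u v, `|h u - h v| <= K * `|phi u - phi v|}.
Proof.
move=> hdec phic hrat u v.
wlog uv : u v / u <= v.
  move=> H uI vI; have [/H|/ltW /H] := leP u v; first exact.
  by rewrite distrC (distrC (phi u)); exact.
move=> uI vI; move: (uI) (vI); rewrite !in_itv/= => /andP[au ub] /andP[av vb].
have contl (x y : R) : x \in `]a, b[ ->
    {for x, continuous (fun z => K * `|phi z - y|)}.
  move=> xI; apply: cvgM; first exact: cvg_cst.
  by apply: cvg_norm; apply: cvgB; [exact: phic|exact: cvg_cst].
apply: (@le_continuous_of_rat _ (fun z => K * `|phi z - phi v|) a u) => //.
- by rewrite lexx ltW.
- exact: contl.
move=> r; rewrite in_itv/= => /andP[ar ru].
rewrite (distrC (phi _)).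
apply: (@le_continuous_of_rat _ (fun z => K * `|phi z - phi (ratr r)|) v b) => //.
- by rewrite lexx ltW.
- exact: contl.
move=> s; rewrite in_itv/= => /andP[vs sb].
have rI : ratr r \in `]a, b[ by rewrite in_itv/= ar/=; lra.
have sI : ratr s \in `]a, b[ by rewrite in_itv/= sb andbT; lra.
have hur := hdec _ _ uI rI (ltW ru).
have hsv := hdec _ _ sI vI (ltW vs).
have huv := hdec _ _ vI uI uv.
have := hrat s r sI rI.
by apply: le_trans; rewrite ger0_norm ?ler0_norm; lra.
Qed.

Lemma modulus_at_left (R : realType) (h phi : R -> R) (K a b u : R) :
  u \in `]a, b[ ->
  {in `]a, b[ &, forall u v, `|h u - h v| <= K * `|phi u - phi v|} ->
  h v @[v --> b^'-] --> h b -> {for b, continuous phi} ->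
  `|h u - h b| <= K * `|phi u - phi b|.
Proof.
move=> uI hK hb phib.
have phib' : phi v @[v --> b^'-] --> phi b by exact: cvg_at_left_filter.
rewrite -subr_ge0.
apply: (@cvgr_to_ge _ b^'- _ _
  (fun v => K * `|phi u - phi v| - `|h u - h v|)).
  apply: cvgB; first apply: cvgM.
  - exact: cvg_cst.
  - by apply: cvg_norm; apply: cvgB => //; exact: cvg_cst.
  - by apply: cvg_norm; apply: cvgB => //; exact: cvg_cst.
move: (uI); rewrite in_itv/= => /andP[au ub].
near=> v; rewrite subr_ge0; apply: hK => //; rewrite in_itv/=.
apply/andP; split; last by near: v; exact: nbhs_left_lt.
by apply: (lt_trans au); near: v; exact: nbhs_left_gt.
Unshelve. all: by end_near. Qed.

Lemma CF_ae_modulus (R : realType) (n : nat) (alpha lambda t eps : R)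
    (M p : sphere R n -> R) (sigma : {finite_measure set (sphere R n) -> \bar R})
    (q : sphere R n -> R -> R) :
  (forall xi (u v : R), 0 < u -> u <= v -> q xi v <= q xi u) ->
  CF alpha lambda t eps M p sigma q ->
  {ae sigma, forall xi, {in `]0, eps[ &, forall u v,
    `|q xi u - q xi v| <= M xi * `|u `^ p xi - v `^ p xi|}}.
Proof.
move=> qdec [_ _ _ _ qM].
(* Numbering the pairs makes the exceptional sets a sequence; numbers that
   encode no pair impose no condition. *)
pose P (rs : option (rat * rat)) xi := if rs is Some (r, s) then
  ratr r \in `]0, eps[ -> ratr s \in `]0, eps[ ->
  `|q xi (ratr r) - q xi (ratr s)| <=
    M xi * `|ratr r `^ p xi - ratr s `^ p xi| else True.
have : {ae sigma, forall xi, forall k, P (unpickle k) xi}.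
  apply: ae_foralln => k; case: (unpickle k) => [[r s]|]; last exact: aeW.
  have [rI|rI] := boolP ((ratr r : R) \in `]0, eps[); last first.
    by apply: aeW => xi /=; rewrite (negbTE rI).
  have [sI|sI] := boolP ((ratr s : R) \in `]0, eps[); last first.
    by apply: aeW => xi /=; rewrite (negbTE sI).
  rewrite !in_itv/= in rI sI.
  by apply: filterS (qM _ _ rI sI) => xi ? _ _.
apply: filterS => xi Pxi.
apply: (@modulus_of_rat _ (q xi) (fun x => x `^ p xi)).
- by move=> x y; rewrite !in_itv/= => _ /andP[y0 _]; exact: qdec.
- by move=> x; rewrite in_itv/= => /andP[x0 _]; exact: continuous_powRl.
- by move=> r s; have := Pxi (pickle (r, s)); rewrite pickleK.
Qed.

(** The middle factor of [V1] is the inverse of the normalising constant of MLL.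
    Factoring u^(-1-alpha) out of both branches of the density leaves u^p or 1,
    the form in which the increment of q is estimated. *)
Lemma V1_mll_pdf (R : realType) (n : nat) (alpha lambda t delta : R)
    (q : sphere R n -> R -> R) (M p : sphere R n -> R) (xi : sphere R n)
    (u : R) :
  0 < alpha -> alpha < p xi -> 0 < delta -> 0 < u ->
  V1 alpha lambda t q M p delta xi * mll_pdf alpha (p xi) delta u =
  kappa alpha lambda t q xi *
    (Num.max 1 (M xi * (expR (p xi * lambda * t) - 1)) *
     ((if u <= delta then u `^ p xi else 1) * u `^ (- 1 - alpha))).
Proof.
move=> a0 ap d0 u0; rewrite /V1 /mll_pdf.
have -> : u `^ (p xi - alpha - 1) * \1_`]0, delta] u +
    u `^ (- 1 - alpha) * \1_`]delta, +oo[ u =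
    (if u <= delta then u `^ p xi else 1) * u `^ (- 1 - alpha).
  rewrite !indicE.
  have -> : (u \in `]0, delta]%classic) = (u <= delta).
    by rewrite mem_setE in_itv/= u0.
  have -> : (u \in `]delta, +oo[%classic) = ~~ (u <= delta).
    by rewrite mem_setE in_itv/= andbT ltNge.
  case: ifP => _ /=; rewrite !(mulr0, mulr1, mul1r, add0r, addr0)//.
  rewrite -powRD; last by rewrite (gt_eqF u0) implybT.
  by congr (_ `^ _); ring.
have dA : delta `^ alpha != 0 by rewrite gt_eqF ?powR_gt0.
have pa : p xi - alpha != 0 by rewrite subr_eq0 gt_eqF.
have S : alpha * delta `^ p xi + p xi - alpha != 0.
  rewrite gt_eqF//.
  by have := mulr_ge0 (ltW a0) (powR_ge0 delta (p xi)); lra.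
by field; rewrite pa S dA gt_eqF.
Qed.

Theorem proposition1 (R : realType) (n : nat) (alpha lambda t : R)
    (sigma : {finite_measure set (sphere R n) -> \bar R})
    (q : sphere R n -> R -> R)
    (eps : R) (M p : sphere R n -> R)
    (halpha : 0 < alpha < 2) (hlambda : 0 < lambda) (ht : 0 < t)
    (hq_borel : measurable_fun [set z : sphere R n * R | 0 < z.2]
                  (fun z : sphere R n * R => q z.1 z.2))
    (hq01 : forall (xi : sphere R n) (u : R), 0 < u -> 0 <= q xi u <= 1)
    (hq_noninc : forall (xi : sphere R n) (u v : R),
                   0 < u -> u <= v -> q xi v <= q xi u)
    (hq_CF : CF alpha lambda t eps M p sigma q) :
  let delta0 := eps * expR (- (lambda * t)) in
  {ae sigma, forall xi : sphere R n,
    (0 < f_mass alpha lambda t q xi)%E ->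
    forall u : R, 0 < u ->
      (u = delta0 -> q xi v @[v --> eps^'-] --> q xi eps) ->
      f_dens alpha lambda t q xi u <=
        V1 alpha lambda t q M p delta0 xi * mll_pdf alpha (p xi) delta0 u}.
Proof.
move=> delta0; have [a0 _] := andP halpha.
have [eps0 [_ p0] _ [pinf _] _] := hq_CF.
have delta0_gt0 : 0 < delta0 by rewrite mulr_gt0// expR_gt0.
apply: filterS (CF_ae_modulus hq_noninc hq_CF) => xi qM mass_gt0 u u0 qeps.
have ap : alpha < p xi.
  apply: (lt_le_trans pinf); apply: ge_inf; last by exists xi.
  by exists 0 => _ [z _ <-].
rewrite V1_mll_pdf// /f_dens /f_unnorm ler_wpM2l//.
  by rewrite invr_ge0 fine_ge0// ltW.
rewrite mulrA ler_wpM2r ?powR_ge0//.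
set e := expR (lambda * t); set C := M xi * _.
have e1 : 1 < e by rewrite expR_gt1 mulr_gt0.
have e0 : 0 < e := expR_gt0 _.
have uue : u < u * e by rewrite ltr_pMr.
have delta0e : delta0 * e = eps.
  by rewrite /delta0 /e expRN -mulrA mulVf ?mulr1// gt_eqF ?expR_gt0.
case: ifPn => [ud|_]; last first.
  have /andP[_ q1] := hq01 xi u u0.
  have /andP[q0 _] := hq01 xi (u * e) (mulr_gt0 u0 e0).
  by rewrite mulr1 le_max; apply/orP; left; lra.
apply: (@le_trans _ _ (C * u `^ p xi)); last first.
  by rewrite ler_wpM2r ?powR_ge0// le_max lexx orbT.
have -> : C * u `^ p xi = M xi * `|u `^ p xi - (u * e) `^ p xi|.
  rewrite (powRM _ (ltW u0) (ltW e0)) -expRM ler0_norm; last first.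
    have : 1 <= expR (lambda * t * p xi).
      by rewrite -expR0 ler_expR !mulr_ge0// ltW.
    by have := powR_ge0 u (p xi); nra.
  rewrite /C (_ : p xi * lambda * t = lambda * t * p xi); last by ring.
  by ring.
apply: (le_trans (ler_norm _)).
have uI : u \in `]0, eps[.
  by rewrite in_itv/= u0/= (lt_le_trans uue)// -delta0e ler_pM2r.
move: ud; rewrite le_eqVlt => /predU1P[ud|ud]; last first.
  by apply: qM => //; rewrite in_itv/= mulr_gt0//= -delta0e ltr_pM2r.
have -> : u * e = eps by rewrite ud.
apply: (@modulus_at_left _ (q xi) (fun x => x `^ p xi) _ 0) => //.
  exact: qeps.
exact: continuous_powRl.
Qed.
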